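(* Fix $p\in(1,2]$, $r>0$ and a positive integer $n$. The set $\mathbb{B}_p(r)=\{x\in\mathbb{R}^n : \|x\|_p\le r\}$ is $\frac{p-1}{r}$-strongly convex with respect to the norm $\|\cdot\|_p$ and $\frac{(p-1)\,n^{\frac12-\frac1p}}{r}$-strongly convex with respect to the norm $\|\cdot\|_2$.
   Context: A convex set $\mathcal{K}$ in a finite-dimensional real vector space $E$ is $\alpha$-strongly convex with respect to a norm $\|\cdot\|$ on $E$ if for any $x,y\in\mathcal{K}$, any $\gamma\in[0,1]$ and any $z\in E$ with $\|z\|=1$, it holds that $\gamma x+(1-\gamma)y+\gamma(1-\gamma)\frac{\alpha}{2}\|x-y\|^2 z\in\mathcal{K}$. Here $\|x\|_p=(\sum_{i}|x_i|^p)^{1/p}$. *)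

(* Defs.v *)
From HB Require Import structures.
From mathcomp Require Import all_boot all_order all_algebra.
From mathcomp Require Import all_classical all_reals all_analysis.

Set Implicit Arguments.
Unset Strict Implicit.
Unset Printing Implicit Defensive.

Import Order.TTheory GRing.Theory Num.Theory.

Local Open Scope classical_set_scope.
Local Open Scope ring_scope.

(* A predicate rather than a normedModType structure, because one space is
   considered with several norms. Nonnegativity follows from the three laws. *)
Record is_norm (R : realType) (E : lmodType R) (N : E -> R) : Prop := IsNorm {
  is_norm_triangle : forall x y : E, N (x + y) <= N x + N y;
  is_norm_homogeneous : forall (a : R) (x : E), N (a *: x) = `|a| * N x;
  is_norm_definite : forall x : E, N x = 0 -> x = 0
}.

(* That N is a norm and that K is convex are part of the notion, hence the
   first two conjuncts; a vectType is a finite-dimensional vector space. *)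
Definition strongly_convex (R : realType) (E : vectType R) (N : E -> R)
    (alpha : R) (K : set E) : Prop :=
  [/\ is_norm N,
      convex_set (K : set (convex_lmodType E))
    & forall (x y : E) (gamma : R) (z : E),
        K x -> K y -> 0 <= gamma <= 1 -> N z = 1 ->
        K (gamma *: x + (1 - gamma) *: y
           + (gamma * (1 - gamma) * (alpha / 2) * N (x - y) ^+ 2) *: z)].

(* Not the library norm `|x| of a row vector, which is the maximum norm. *)
Definition lpnorm (R : realType) (p : R) (n : nat) (x : 'rV[R]_n) : R :=
  (\sum_(i < n) `|x 0 i| `^ p) `^ (1 / p).

Definition lpball (R : realType) (p : R) (n : nat) (r : R) : set 'rV[R]_n :=
  [set x | lpnorm p x <= r].

Arguments lpnorm {R} p n x.
Arguments lpball {R} p n r.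

(* Main.v *)
(* The squared norm has the variational form
     |x|_p^2 = inf { sum_i x_i^2 w_i^(-s) : w_i > 0, sum_i w_i = 1 },
   s = (2 - p) / p, a reverse Hoelder inequality. Along a segment
   (X, W) = (x + t h, u + t k) the second derivative of X^2 W^(-s) is a
   quadratic form in h and k whose minimum over k is
   2 (1 - s) / (1 + s) h^2 W^(-s), and (1 - s) / (1 + s) = p - 1. Summing over
   the coordinates and applying the variational inequality to h shows that
   |.|_p^2 / 2 is (p - 1)-strongly convex with respect to |.|_p. Minkowski's
   inequality follows by homogeneity, and the strong convexity of the ball of
   radius r follows from 2 r |m|_p <= r^2 + |m|_p^2. For the Euclidean norm, use
   |.|_2 <= |.|_p <= n^(1/p - 1/2) |.|_2. *)
Require Import Defs.
From HB Require Import structures.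
From mathcomp Require Import all_boot all_order all_algebra.
From mathcomp Require Import all_classical all_reals all_analysis.
From mathcomp Require Import ring lra.

Import Order.TTheory GRing.Theory Num.Theory.
Import numFieldNormedType.Exports.

Local Open Scope classical_set_scope.
Local Open Scope ring_scope.

(** * Chord inequalities from lower bounds on the second derivative *)

Lemma continuous_of_is_derive (R : realType) (f df : R -> R) (a b : R) :
  (forall x : R, x \in `[a, b]%R -> is_derive x 1 f (df x)) ->
  {within `[a, b], continuous f}.
Proof.
move=> fd; apply: derivable_within_continuous => x xab.
by have [] := fd x xab.
Qed.

(** The mean value theorem on [[0, t]] and on [[t, 1]] turns the two chord slopes into [df c1] and
    [df c2] with [c1 <= c2]; applied once more, to [df], it orders these slopes. *)
Lemma convex_chord (R : realType) (f df ddf : R -> R) (t : R) :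
  (forall x : R, x \in `[0, 1]%R -> is_derive x 1 f (df x)) ->
  (forall x : R, x \in `[0, 1]%R -> is_derive x 1 df (ddf x)) ->
  (forall x : R, x \in `[0, 1]%R -> 0 <= ddf x) ->
  0 <= t <= 1 -> f t <= (1 - t) * f 0 + t * f 1.
Proof.
move=> fd dfd ddf0 /andP[t0 t1].
have MV (g dg : R -> R) (a b : R) : 0 <= a -> a <= b -> b <= 1 ->
    (forall x : R, x \in `[0, 1]%R -> is_derive x 1 g (dg x)) ->
    exists2 c : R, c \in `[a, b]%R & g b - g a = dg c * (b - a).
  move=> a0 ab b1 gd.
  have gab (x : R) : x \in `[a, b]%R -> is_derive x 1 g (dg x).
    rewrite in_itv /= => /andP[ax xb]; apply: gd.
    by rewrite in_itv /= (le_trans a0 ax) (le_trans xb b1).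
  have gd' (x : R) : x \in `]a, b[%R -> is_derive x 1 g (dg x).
    by move=> /subset_itv_oo_cc; exact: gab.
  have [c cab E] := MVT_segment ab gd' (continuous_of_is_derive _ _ _ _ _ gab).
  by exists c.
have [c1] := MV f df 0 t (lexx _) t0 t1 fd.
rewrite in_itv /= => /andP[c10 c1t] E1.
have [c2] := MV f df t 1 t0 t1 (lexx _) fd.
rewrite in_itv /= => /andP[tc2 c21] E2.
have [c] := MV df ddf c1 c2 c10 (le_trans c1t tc2) c21 dfd.
rewrite in_itv /= => /andP[c1c cc2] E3.
have c01 : c \in `[0, 1]%R by rewrite in_itv /=; lra.
have D : df c1 <= df c2.
  by rewrite -subr_ge0 E3 mulr_ge0 ?ddf0//; lra.
have : 0 <= t * (1 - t) * (df c2 - df c1) by rewrite !mulr_ge0//; lra.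
have -> : t * (1 - t) * (df c2 - df c1) =
  t * (df c2 * (1 - t)) - (1 - t) * (df c1 * (t - 0)) by ring.
by rewrite -E1 -E2; lra.
Qed.

(** Subtracting [c * x ^+ 2], whose second derivative is [2 * c], leaves a convex function. *)
Lemma strongly_convex_chord (R : realType) (f df ddf : R -> R) (c t : R) :
  (forall x : R, x \in `[0, 1]%R -> is_derive x 1 f (df x)) ->
  (forall x : R, x \in `[0, 1]%R -> is_derive x 1 df (ddf x)) ->
  (forall x : R, x \in `[0, 1]%R -> 2 * c <= ddf x) ->
  0 <= t <= 1 -> f t + c * (t * (1 - t)) <= (1 - t) * f 0 + t * f 1.
Proof.
move=> fd dfd ddfc t01.
pose g x := f x - c * x ^+ 2.
suff: g t <= (1 - t) * g 0 + t * g 1 by rewrite /g; lra.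
apply: (@convex_chord _ g (fun x => df x - 2 * c * x)
  (fun x => ddf x - 2 * c)) => //.
- move=> x x01; have := fd x x01 => ?.
  apply: is_derive_eq.
  by rewrite /GRing.scale /= !mulr1; ring.
- move=> x x01; have := dfd x x01 => ?.
  apply: is_derive_eq.
  by rewrite /GRing.scale /= !mulr1; ring.
- by move=> x x01; rewrite subr_ge0 ddfc.
Qed.

(** * Weighted squares along a segment *)

Lemma is_derive_powR_affine (R : realType) (u k e t : R) : 0 < u + t * k ->
  is_derive t 1 (fun t => (u + t * k) `^ e) (e * k * (u + t * k) `^ (e - 1)).
Proof.
move=> W0.
have D := @is_derive1_powR R e _ W0.
have Dg : is_derive t 1 (fun t : R => u + t * k) k.
  by apply: is_derive_eq; rewrite /GRing.scale /=; ring.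
have H := @is_derive1_comp R (fun a : R => a `^ e) (fun t : R => u + t * k)
  t _ k D Dg.
rewrite (_ : e * k * _ = e * (u + t * k) `^ (e - 1) * k); last by ring.
exact: H.
Qed.

Lemma weighted_square_derive (R : realType) (x h u k s t : R) : 0 < u + t * k ->
  is_derive t 1 (fun t => (x + t * h) ^+ 2 * (u + t * k) `^ (- s))
    (2 * h * (x + t * h) * (u + t * k) `^ (- s)
     - s * k * ((x + t * h) ^+ 2 * (u + t * k) `^ (- s - 1))).
Proof.
move=> W0; have D := @is_derive_powR_affine R u k (- s) t W0.
apply: is_derive_eq.
by rewrite /GRing.scale /=; ring.
Qed.

(** Factoring out the power [- s - 2] leaves a quadratic form in [a = h * (u + t * k)] and
    [b = k * (x + t * h)], ready to be minimized over [b]. *)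
Lemma weighted_square_derive2 (R : realType) (x h u k s t : R) :
  0 < u + t * k ->
  is_derive t 1 (fun t => 2 * h * (x + t * h) * (u + t * k) `^ (- s)
     - s * k * ((x + t * h) ^+ 2 * (u + t * k) `^ (- s - 1)))
   ((2 * (h * (u + t * k)) ^+ 2
     - 4 * s * (h * (u + t * k)) * (k * (x + t * h))
     + s * (s + 1) * (k * (x + t * h)) ^+ 2) * (u + t * k) `^ (- s - 2)).
Proof.
move=> W0; have D := @is_derive_powR_affine R u k (- s) t W0.
have D1 := @is_derive_powR_affine R u k (- s - 1) t W0.
apply: is_derive_eq.
have powS (w e : R) (m : nat) : 0 < w -> w `^ (e + m%:R) = w `^ e * w ^+ m.
  move=> w0; rewrite powRD; last by rewrite (gt_eqF w0) implybT.
  by rewrite powR_mulrn// ltW.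
have E1 : (u + t * k) `^ (- s - 1) = (u + t * k) `^ (- s - 2) * (u + t * k).
  by rewrite -[in RHS](expr1 (u + t * k)) -powS//; congr (_ `^ _); ring.
have E0 : (u + t * k) `^ (- s) = (u + t * k) `^ (- s - 2) * (u + t * k) ^+ 2.
  by rewrite -powS//; congr (_ `^ _); ring.
have -> : - s - 1 - 1 = - s - 2 by ring.
rewrite E1 E0 /GRing.scale /=; ring.
Qed.

(** Completing the square in [b]: the minimum is at [b = 2 * a / (1 + s)]. *)
Lemma weighted_square_hessian (R : realFieldType) (a b s : R) : 0 <= s ->
  2 * ((1 - s) / (1 + s)) * a ^+ 2
    <= 2 * a ^+ 2 - 4 * s * a * b + s * (s + 1) * b ^+ 2.
Proof.
move=> s0; rewrite -subr_ge0.
have -> : 2 * a ^+ 2 - 4 * s * a * b + s * (s + 1) * b ^+ 2 -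
    2 * ((1 - s) / (1 + s)) * a ^+ 2 =
    s / (1 + s) * (2 * a - (1 + s) * b) ^+ 2.
  by field; apply: lt0r_neq0; lra.
by rewrite mulr_ge0 ?sqr_ge0// divr_ge0//; lra.
Qed.

Lemma is_derive_sum_pointwise (R : realType) (n : nat)
    (f : 'I_n -> R -> R) (df : 'I_n -> R) (t : R) :
  (forall i, is_derive t 1 (f i) (df i)) ->
  is_derive t 1 (fun t => \sum_(i < n) f i t) (\sum_(i < n) df i).
Proof.
move=> fd; rewrite (_ : (fun _ => _) = \sum_(i < n) f i).
  exact: is_derive_sum.
by apply/funext => z; rewrite fct_sumE.
Qed.

Lemma line_gt0 (R : realFieldType) (a b t : R) :
  0 < a -> 0 < b -> 0 <= t <= 1 -> 0 < (1 - t) * a + t * b.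
Proof.
move=> a0 b0 /andP[t0 t1].
have [->|tn0] := eqVneq t 0; first by rewrite subr0 mul1r mul0r addr0.
rewrite ltr_wpDl ?mulr_ge0 ?subr_ge0 ?(ltW a0)//.
by rewrite mulr_gt0// lt_neqAle eq_sym tn0.
Qed.

(** The bound on [c] is asked at every interpolated weight, since the second derivative must be
    bounded below along the whole segment. For weights of total mass one the variational inequality
    supplies it. *)
Lemma weighted_square_chord (R : realType) (n : nat) (s c t : R)
    (x y u v : 'I_n -> R) :
  0 <= s -> (forall i, 0 < u i) -> (forall i, 0 < v i) ->
  (forall z, 0 <= z <= 1 ->
    c <= (1 - s) / (1 + s) *
      \sum_i (y i - x i) ^+ 2 * ((1 - z) * u i + z * v i) `^ (- s)) ->
  0 <= t <= 1 ->
  \sum_i ((1 - t) * x i + t * y i) ^+ 2 * ((1 - t) * u i + t * v i) `^ (- s)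
    + c * (t * (1 - t))
  <= (1 - t) * (\sum_i x i ^+ 2 * u i `^ (- s))
     + t * (\sum_i y i ^+ 2 * v i `^ (- s)).
Proof.
move=> s0 u0 v0 hc t01.
have line (a b z : R) : (1 - z) * a + z * b = a + z * (b - a) by ring.
pose W i z := u i + z * (v i - u i).
pose X i z := x i + z * (y i - x i).
have W0 i z : 0 <= z <= 1 -> 0 < W i z.
  by move=> z01; rewrite /W -line line_gt0.
pose f z := \sum_i X i z ^+ 2 * W i z `^ (- s).
suff: f t + c * (t * (1 - t)) <= (1 - t) * f 0 + t * f 1.
  have -> : f 0 = \sum_i x i ^+ 2 * u i `^ (- s).
    by apply: eq_bigr => i _; rewrite /X /W !mul0r !addr0.
  have -> : f 1 = \sum_i y i ^+ 2 * v i `^ (- s).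
    by apply: eq_bigr => i _; rewrite /X /W !mul1r !subrKC.
  suff -> : f t = \sum_i ((1 - t) * x i + t * y i) ^+ 2 *
    ((1 - t) * u i + t * v i) `^ (- s) by [].
  by apply: eq_bigr => i _; rewrite !line.
pose df z := \sum_i (2 * (y i - x i) * X i z * W i z `^ (- s)
  - s * (v i - u i) * (X i z ^+ 2 * W i z `^ (- s - 1))).
pose ddf z := \sum_i (2 * ((y i - x i) * W i z) ^+ 2
  - 4 * s * ((y i - x i) * W i z) * ((v i - u i) * X i z)
  + s * (s + 1) * ((v i - u i) * X i z) ^+ 2) * W i z `^ (- s - 2).
have fd (z : R) : z \in `[0, 1]%R -> is_derive z 1 f (df z).
  move=> z01; refine (is_derive_sum_pointwise _ _ _ _ _ _) => i.
  exact: (weighted_square_derive _ _ _ _ _ _ _ (W0 i z z01)).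
have dfd (z : R) : z \in `[0, 1]%R -> is_derive z 1 df (ddf z).
  move=> z01; refine (is_derive_sum_pointwise _ _ _ _ _ _) => i.
  exact: (weighted_square_derive2 _ _ _ _ _ _ _ (W0 i z z01)).
apply: (strongly_convex_chord _ _ _ _ _ _ fd dfd _ t01) => z z01.
rewrite in_itv /= in z01.
apply: (@le_trans _ _ (2 * ((1 - s) / (1 + s) *
      \sum_i (y i - x i) ^+ 2 * ((1 - z) * u i + z * v i) `^ (- s)))).
  by rewrite ler_pM2l// hc.
rewrite mulrA mulr_sumr; apply: ler_sum => i _; rewrite line -/(W i z).
(* The form is bounded in each coordinate with [a = (y i - x i) * W i z]; the factor [W i z ^+ 2] in
   [a ^+ 2] then raises the exponent from [- s - 2] to [- s]. *)
apply: le_trans (ler_wpM2r (powR_ge0 _ _) (weighted_square_hessian _ _ _ _ s0)).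
have Wz := W0 i _ z01.
have -> : W i z `^ (- s) = W i z `^ (- s - 2) * W i z ^+ 2.
  rewrite -powR_mulrn ?(ltW Wz)// -powRD; last by rewrite (gt_eqF Wz) implybT.
  by congr (_ `^ _); ring.
by rewrite le_eqVlt; apply/orP; left; apply/eqP; ring.
Qed.

(** * Young's and Hoelder's inequalities with weights *)

Lemma young_powR (R : realType) (a b q : R) : 0 <= a -> 0 <= b -> 0 < q <= 1 ->
  a `^ q * b `^ (1 - q) <= q * a + (1 - q) * b.
Proof.
(* At [q = 1] the exponent conjugate to [q^-1] would be infinite, so this case is split off. *)
move=> a0 b0 /andP[q0]; rewrite le_eqVlt => /predU1P[->|q1].
  by rewrite subrr powRr0 mulr1 mul0r addr0 mul1r powRr1.
have q1' : 0 < 1 - q by rewrite subr_gt0.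
have := @conjugate_powR R (a `^ q) (b `^ (1 - q)) q^-1 (1 - q)^-1
  (powR_ge0 _ _) (powR_ge0 _ _).
rewrite !invr_gt0 !invrK q0 q1' => /(_ isT isT).
rewrite subrKC => /(_ erefl).
rewrite -!powRrM !mulfV ?gt_eqF// !powRr1// => H.
by rewrite [q * _]mulrC [(1 - q) * _]mulrC.
Qed.

(** After division of [b] by its sum, Young's inequality in each coordinate adds up to
    [q + (1 - q) = 1]. *)
Lemma hoelder_weight (R : realType) (n : nat) (b w : 'I_n -> R) (q : R) :
  0 < q <= 1 -> (forall i, 0 <= b i) -> (forall i, 0 <= w i) ->
  \sum_i w i = 1 ->
  \sum_i b i `^ q * w i `^ (1 - q) <= (\sum_i b i) `^ q.
Proof.
move=> q01 b0 w0 w1; set B := \sum_i b i.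
have /andP[q0 q1] := q01.
have B0 : 0 <= B by apply: sumr_ge0.
have [BE|Bn0] := eqVneq B 0.
  rewrite big1 ?powR_ge0// => i _.
  have /psumr_eq0P := BE => /(_ (fun i _ => b0 i)) -> //.
  by rewrite powR0 ?mul0r// gt_eqF.
have Bp : 0 < B by rewrite lt_neqAle eq_sym Bn0.
have -> : B `^ q = B `^ q * (\sum_i (q * (b i / B) + (1 - q) * w i)).
  rewrite big_split /= -!mulr_sumr w1 -mulr_suml -/B mulfV// !mulr1 subrKC.
  by rewrite mulr1.
rewrite mulr_sumr; apply: ler_sum => i _.
have bB : 0 <= b i / B by rewrite divr_ge0.
have -> : b i `^ q = B `^ q * (b i / B) `^ q.
  by rewrite -powRM// mulrC mulfVK.
rewrite -mulrA.
by rewrite ler_wpM2l ?powR_ge0// young_powR.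
Qed.

(** * The variational form of the squared norm *)

Section lpnorm_weights.
Context {R : realType} (p : R) (hp : 1 < p <= 2).

Let p0 : 0 < p. Proof. by have /andP[/(lt_trans ltr01)] := hp. Qed.

Lemma lpnorm_ge0 n (x : 'rV[R]_n) : 0 <= lpnorm p n x.
Proof. exact: powR_ge0. Qed.

Lemma lpnorm_sqr n (x : 'rV[R]_n) :
  lpnorm p n x ^+ 2 = (\sum_i `|x 0 i| `^ p) `^ (2 / p).
Proof.
by rewrite -powR_mulrn ?powR_ge0// -powRrM; congr (_ `^ _); ring.
Qed.

Lemma lpnorm_powR n (x : 'rV[R]_n) :
  lpnorm p n x `^ p = \sum_i `|x 0 i| `^ p.
Proof.
rewrite -powRrM mul1r mulVf ?gt_eqF// powRr1//.
by apply: sumr_ge0 => i _; exact: powR_ge0.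
Qed.

(** Hoelder with [q = p / 2], applied to the weighted squares [b]: the powers of [w i] cancel and
    [|x_i|^p] remains. *)
Lemma lpnorm_sqr_le_weighted n (x : 'rV[R]_n) (w : 'I_n -> R) :
  (forall i, 0 < w i) -> \sum_i w i = 1 ->
  lpnorm p n x ^+ 2 <= \sum_i x 0 i ^+ 2 * w i `^ (- ((2 - p) / p)).
Proof.
move=> w0 w1; have /andP[p1 p2] := hp.
set b := fun i => x 0 i ^+ 2 * w i `^ (- ((2 - p) / p)).
have b0 i : 0 <= b i by rewrite mulr_ge0 ?sqr_ge0 ?powR_ge0.
have pn0 : p != 0 by rewrite gt_eqF.
have H : \sum_i `|x 0 i| `^ p <= (\sum_i b i) `^ (p / 2).
  apply: le_trans
    (@hoelder_weight R n b w (p / 2) _ b0 (fun i => ltW (w0 i)) w1).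
    rewrite le_eqVlt; apply/orP; left; apply/eqP; apply: eq_bigr => i _.
    rewrite /b powRM ?sqr_ge0 ?powR_ge0// -powRrM -mulrA -powRD; last first.
      by rewrite (gt_eqF (w0 i)) implybT.
    rewrite (_ : - _ * _ + _ = 0); last by field.
    rewrite powRr0 mulr1 -real_normK ?num_real// -powR_mulrn// -powRrM.
    by congr (_ `^ _); field.
  by apply/andP; split; lra.
rewrite lpnorm_sqr.
have S0 : 0 <= \sum_i `|x 0 i| `^ p by apply: sumr_ge0 => i _; exact: powR_ge0.
have B0 : 0 <= \sum_i b i by apply: sumr_ge0.
apply: (@le_trans _ _ ((\sum_i b i) `^ (p / 2) `^ (2 / p))).
  by rewrite ge0_ler_powR ?nnegrE ?powR_ge0// divr_ge0// ltW.
rewrite -powRrM (_ : p / 2 * (2 / p) = 1) ?powRr1//.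
by field.
Qed.

(* The optimal weights |x_i|^p / |x|_p^p may vanish; the slack a - |x|_p is
   spread uniformly to make them positive. *)
Lemma lpnorm_lt_weights n (x : 'rV[R]_n) (a : R) : (0 < n)%N ->
  lpnorm p n x < a ->
  exists w : 'I_n -> R, [/\ forall i, 0 < w i, \sum_i w i = 1
    & \sum_i x 0 i ^+ 2 * w i `^ (- ((2 - p) / p)) <= a ^+ 2].
Proof.
move=> n0 xa; have /andP[p1 p2] := hp.
have pn0 : p != 0 by rewrite gt_eqF.
have a0 : 0 < a := le_lt_trans (lpnorm_ge0 _ x) xa.
set S := \sum_i `|x 0 i| `^ p; set A := a `^ p.
have A0 : 0 < A by rewrite powR_gt0.
have SA : S < A.
  by rewrite /S -lpnorm_powR gt0_ltr_powR ?nnegrE ?lpnorm_ge0// ltW.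
have nR : n%:R != 0 :> R by rewrite pnatr_eq0 -lt0n.
(* With this [e] the numbers [|x_i|^p + e] add up to [A]. *)
pose e := (A - S) / n%:R.
have e0 : 0 < e by rewrite divr_gt0 ?subr_gt0// ltr0n.
have d0 i : 0 < `|x 0 i| `^ p + e by rewrite ltr_wpDl ?powR_ge0.
exists (fun i => (`|x 0 i| `^ p + e) / A); split.
- by move=> i; rewrite divr_gt0.
- rewrite -mulr_suml big_split /= -/S sumr_const card_ord -mulr_natr.
  by rewrite /e mulfVK// subrKC mulfV// gt_eqF.
- set s := (2 - p) / p.
  have s0 : 0 <= s by rewrite divr_ge0 ?subr_ge0// ltW.
  apply: (@le_trans _ _ (\sum_i `|x 0 i| `^ p * A `^ s)).
    apply: ler_sum => i _.
    rewrite powRM ?invr_ge0 ?(ltW (d0 i)) ?(ltW A0)//.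
    rewrite -[A^-1]powR_inv1 ?(ltW A0)// -powRrM mulN1r opprK mulrA.
    rewrite ler_wpM2r ?powR_ge0//.
    rewrite powRN ler_pdivrMr ?powR_gt0//.
    apply: (@le_trans _ _ (`|x 0 i| `^ p * (`|x 0 i| `^ p) `^ s)).
      have -> : x 0 i ^+ 2 = `|x 0 i| `^ (p + p * s).
        rewrite -real_normK ?num_real// -powR_mulrn//; congr (_ `^ _).
        by rewrite /s; field.
      rewrite powRD -?powRrM//.
      (* The coordinate may vanish, and the exponent law at base zero requires a nonzero total
         exponent. *)
      apply/implyP => /eqP E; exfalso; have : 0 < p + p * s.
        by rewrite ltr_pwDl// mulr_ge0// ltW.
      by rewrite E ltxx.
    rewrite ler_wpM2l ?powR_ge0// ge0_ler_powR ?nnegrE ?powR_ge0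
      ?(ltW (d0 i))//.
    by rewrite lerDl ltW.
  rewrite -mulr_suml -/S.
  apply: (@le_trans _ _ (A * A `^ s)).
    by rewrite ler_wpM2r ?powR_ge0// ltW.
  rewrite -[X in X * _]powRr1 ?(ltW A0)// -powRD; last first.
    by rewrite (gt_eqF A0) implybT.
  rewrite /A -powRrM -powR_mulrn ?(ltW a0)//.
  rewrite (_ : p * (1 + s) = 2%:R)//.
  by rewrite /s; field.
Qed.

End lpnorm_weights.

Lemma ler_sqrD_add (R : realFieldType) (a b r : R) :
  0 < r -> a ^+ 2 + b <= r ^+ 2 -> a + b / (2 * r) <= r.
Proof.
move=> r0 abr; have r2 : 0 < 2 * r by rewrite mulr_gt0.
rewrite -lerBrDl ler_pdivrMr//.
by have := sqr_ge0 (r - a); nra.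
Qed.

(** * Strong convexity of the squared norm and of the ball *)

Section lpnorm_norm.
Context {R : realType} (p : R) (hp : 1 < p <= 2) (n : nat) (hn : (0 < n)%N).
Implicit Types (x y z : 'rV[R]_n) (t a r : R).

Let p0 : 0 < p. Proof. by have /andP[/(lt_trans ltr01)] := hp. Qed.

(** Weights adapted to [x] and to [y] are interpolated linearly, so every [w c] is positive with sum
    one. The variational inequality then applies to the combination with [w t], and to [x - y] with
    each [w c]. *)
Lemma lpnorm_strongly_convex_lt x y t a :
  lpnorm p n x < a -> lpnorm p n y < a -> 0 <= t <= 1 ->
  lpnorm p n (t *: x + (1 - t) *: y) ^+ 2
    + (p - 1) * lpnorm p n (x - y) ^+ 2 * (t * (1 - t)) <= a ^+ 2.
Proof.
move=> xa ya t01; have /andP[p1 p2] := hp.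
have [u [u0 u1 ux]] := lpnorm_lt_weights p hp n x a hn xa.
have [v [v0 v1 vy]] := lpnorm_lt_weights p hp n y a hn ya.
set s := (2 - p) / p in ux vy.
have s0 : 0 <= s by rewrite divr_ge0 ?subr_ge0// ltW.
pose w (c : R) i := (1 - c) * v i + c * u i.
have w0 c : 0 <= c <= 1 -> forall i, 0 < w c i.
  by move=> c01 i; exact: line_gt0.
have w1 c : \sum_i w c i = 1.
  by rewrite big_split /= -!mulr_sumr u1 v1 !mulr1 subrK.
have cp : (1 - s) / (1 + s) = p - 1.
  have -> : 1 - s = 2 / p * (p - 1) by rewrite /s; field; rewrite gt_eqF.
  have -> : 1 + s = 2 / p by rewrite /s; field; rewrite gt_eqF.
  by rewrite mulrAC mulfV ?mul1r// mulf_neq0 ?invr_eq0 ?gt_eqF.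
have hc c : 0 <= c <= 1 ->
    (p - 1) * lpnorm p n (x - y) ^+ 2 <= (1 - s) / (1 + s) *
    \sum_i (x 0 i - y 0 i) ^+ 2 * ((1 - c) * v i + c * u i) `^ (- s).
  move=> c01; rewrite cp ler_wpM2l ?subr_ge0 ?(ltW p1)//.
  apply: le_trans
    (lpnorm_sqr_le_weighted p hp n (x - y) (w c) (w0 c c01) (w1 c)) _.
  rewrite le_eqVlt; apply/orP; left; apply/eqP.
  by apply: eq_bigr => i _; rewrite !mxE.
(* The segment starts at [y] and ends at [x], because [t] is the coefficient of [x]. *)
have := @weighted_square_chord R n s _ t
  (fun i => y 0 i) (fun i => x 0 i) v u s0 v0 u0 hc t01.
move=> H; apply: le_trans (le_trans H _).
  rewrite lerD2r.
  apply: le_trans (lpnorm_sqr_le_weighted p hp n _ (w t) (w0 t t01) (w1 t)) _.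
  rewrite le_eqVlt; apply/orP; left; apply/eqP.
  by apply: eq_bigr => i _; rewrite !mxE addrC.
have /andP[t0 t1] := t01.
have -> : a ^+ 2 = (1 - t) * a ^+ 2 + t * a ^+ 2 by ring.
by rewrite lerD// ler_wpM2l// subr_ge0.
Qed.

Lemma lpnorm_strongly_convex x y t r :
  lpnorm p n x <= r -> lpnorm p n y <= r -> 0 <= t <= 1 ->
  lpnorm p n (t *: x + (1 - t) *: y) ^+ 2
    + (p - 1) * lpnorm p n (x - y) ^+ 2 * (t * (1 - t)) <= r ^+ 2.
Proof.
move=> xr yr t01; have /andP[p1 p2] := hp; have /andP[t0 t1] := t01.
have r0 : 0 <= r := le_trans (lpnorm_ge0 p n x) xr.
set L := (X in X <= _).
have L0 : 0 <= L.
  by rewrite addr_ge0 ?sqr_ge0// !mulr_ge0 ?lpnorm_ge0 ?subr_ge0// ltW.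
(* Comparing square roots makes the slack additive: the strict version is used with [a = r + e] for
   every [e > 0]. *)
rewrite -[L]sqr_sqrtr// ler_pXn2r ?nnegrE ?sqrtr_ge0//.
apply/ler_addgt0Pr => e e0.
rewrite -(@ler_pXn2r _ 2) ?nnegrE ?sqrtr_ge0//; last by rewrite addr_ge0// ltW.
by rewrite sqr_sqrtr// lpnorm_strongly_convex_lt// (@le_lt_trans _ _ r)// ltrDl.
Qed.

Lemma lpnorm_conv_le x y t r :
  lpnorm p n x <= r -> lpnorm p n y <= r -> 0 <= t <= 1 ->
  lpnorm p n (t *: x + (1 - t) *: y) <= r.
Proof.
move=> xr yr t01; have /andP[p1 p2] := hp; have /andP[t0 t1] := t01.
have r0 : 0 <= r := le_trans (lpnorm_ge0 p n x) xr.
rewrite -(@ler_pXn2r _ 2) ?nnegrE ?lpnorm_ge0//.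
apply: le_trans (lpnorm_strongly_convex _ _ _ _ xr yr t01).
by rewrite lerDl !mulr_ge0 ?lpnorm_ge0 ?subr_ge0// ltW.
Qed.

Lemma lpnormZ t x : lpnorm p n (t *: x) = `|t| * lpnorm p n x.
Proof.
rewrite /lpnorm.
under eq_bigr do rewrite mxE normrM powRM//.
rewrite -mulr_sumr powRM ?powR_ge0//; last first.
  by apply: sumr_ge0 => i _; exact: powR_ge0.
by rewrite -powRrM mulrC (mulrC p) mul1r mulVf ?gt_eqF// powRr1// mulrC.
Qed.

Lemma lpnorm_eq0 x : lpnorm p n x = 0 -> x = 0.
Proof.
move/powR_eq0_eq0/psumr_eq0P => H; apply/rowP => i; rewrite mxE.
apply: normr0_eq0; apply: (@powR_eq0_eq0 _ _ p).
by apply: H => // j _; exact: powR_ge0.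
Qed.

(* Quasiconvexity and homogeneity give subadditivity: normalize x and y and
   combine them with weights proportional to a and b. *)
Lemma lpnormD_le x y a b : 0 < a -> 0 < b ->
  lpnorm p n x <= a -> lpnorm p n y <= b -> lpnorm p n (x + y) <= a + b.
Proof.
move=> a0 b0 xa yb.
have ab0 : 0 < a + b by rewrite addr_gt0.
have t01 : 0 <= a / (a + b) <= 1.
  by apply/andP; split; rewrite ?divr_ge0 ?ler_pdivrMr ?mul1r ?lerDl// ltW.
have {}xa : lpnorm p n (a^-1 *: x) <= 1.
  by rewrite lpnormZ gtr0_norm ?invr_gt0// mulrC ler_pdivrMr// mul1r.
have {}yb : lpnorm p n (b^-1 *: y) <= 1.
  by rewrite lpnormZ gtr0_norm ?invr_gt0// mulrC ler_pdivrMr// mul1r.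
have := lpnorm_conv_le _ _ _ _ xa yb t01.
have -> : a / (a + b) *: (a^-1 *: x) + (1 - a / (a + b)) *: (b^-1 *: y) =
    (a + b)^-1 *: (x + y).
  have -> : 1 - a / (a + b) = b / (a + b).
    by rewrite -[X in X - _](mulfV (lt0r_neq0 ab0)) -mulrBl addrC addKr.
  by rewrite !scalerA !(mulrAC _ (a + b)^-1) !mulfV ?gt_eqF// !mul1r scalerDr.
by rewrite lpnormZ gtr0_norm ?invr_gt0// mulrC ler_pdivrMr// mul1r.
Qed.

Lemma ler_lpnormD x y : lpnorm p n (x + y) <= lpnorm p n x + lpnorm p n y.
Proof.
(* Adding [e / 2] to each norm gives positive bounds even when a vector is zero. *)
apply/ler_addgt0Pr => e e0; rewrite [e in leRHS]splitr addrACA.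
by apply: lpnormD_le;
  rewrite ?ltr_wpDl ?lpnorm_ge0 ?lerDl ?divr_ge0 ?divr_gt0// ltW.
Qed.

Lemma lpnorm_is_norm : is_norm (lpnorm p n).
Proof.
by split; [exact: ler_lpnormD | exact: lpnormZ | exact: lpnorm_eq0].
Qed.

(** Only the size of the perturbation [z] in the p-norm matters. In this form the lemma serves unit
    vectors of either norm, and [z = 0] gives plain convexity. *)
Lemma lpball_strongly_convex r x y z t : 0 < r ->
  lpball p n r x -> lpball p n r y -> 0 <= t <= 1 ->
  lpnorm p n z <= t * (1 - t) * ((p - 1) / r / 2) * lpnorm p n (x - y) ^+ 2 ->
  lpball p n r (t *: x + (1 - t) *: y + z).
Proof.
rewrite /lpball /= => r0 xr yr t01 zT.
have := lpnorm_strongly_convex _ _ _ _ xr yr t01.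
set T := (X in _ + X <= _) => H.
apply: le_trans (ler_lpnormD _ _) _.
set N := lpnorm p n _ in H *.
have {}zT : lpnorm p n z <= T / (2 * r).
  apply: le_trans zT _; rewrite le_eqVlt; apply/orP; left; apply/eqP.
  by rewrite invfM /T; ring.
apply: (@le_trans _ _ (N + T / (2 * r))); first by rewrite lerD2l.
exact: ler_sqrD_add.
Qed.

Lemma lpball_convex r : 0 < r ->
  convex_set (lpball p n r : set (convex_lmodType _)).
Proof.
move=> r0 x y t /set_mem xr /set_mem yr; apply/mem_set.
have t01 : 0 <= t%:num <= 1 by apply/andP; split.
have := lpball_strongly_convex r x y 0 t%:num r0 xr yr t01.
rewrite addr0; apply.
rewrite -(scale0r (0 : 'rV[R]_n)) lpnormZ normr0 mul0r.
have /andP[p1 _] := hp; have /andP[t0 t1] := t01.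
by rewrite !mulr_ge0 ?lpnorm_ge0 ?subr_ge0 ?invr_ge0// ltW.
Qed.

(** * Comparison with the Euclidean norm *)

Lemma lpnorm2_le x : lpnorm 2 n x <= lpnorm p n x.
Proof.
have /andP[p1 p2] := hp.
have [N0|Nn0] := eqVneq (lpnorm p n x) 0.
  rewrite N0 (lpnorm_eq0 x N0) /lpnorm big1 => [|i _].
    by rewrite powR0// div1r invr_eq0 pnatr_eq0.
  by rewrite mxE normr0 powR0// pnatr_eq0.
set N := lpnorm p n x in Nn0 *.
have Np : 0 < N by rewrite lt_neqAle eq_sym Nn0 lpnorm_ge0.
have S0 : 0 <= \sum_i `|x 0 i| `^ 2.
  by apply: sumr_ge0 => i _; exact: powR_ge0.
(* Since [|x_i| <= N], each [|x_i|^2] is at most [|x_i|^p N^(2-p)], and the [|x_i|^p] add up to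
   [N^p]. *)
suff: \sum_i `|x 0 i| `^ 2 <= N `^ 2.
  move=> H; rewrite /lpnorm.
  apply: (@le_trans _ _ ((N `^ 2) `^ (1 / 2))).
    by rewrite ge0_ler_powR ?nnegrE ?powR_ge0// divr_ge0.
  by rewrite -powRrM div1r mulfV ?pnatr_eq0// powRr1// ltW.
have split2 (c : R) : 0 <= c -> c `^ 2 = c `^ p * c `^ (2 - p).
  move=> c0; rewrite -powRD ?subrKC//; apply/implyP.
  by rewrite pnatr_eq0.
rewrite [N `^ 2]split2 ?(ltW Np)// lpnorm_powR// mulr_suml.
apply: ler_sum => i _; rewrite split2// ler_wpM2l ?powR_ge0//.
rewrite ge0_ler_powR ?nnegrE ?subr_ge0// ?(ltW Np)//.
have : `|x 0 i| `^ p <= N `^ p.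
  rewrite lpnorm_powR// (bigD1 i)//= lerDl.
  by apply: sumr_ge0 => j _; exact: powR_ge0.
apply: contraTT; rewrite -!ltNge => h.
by rewrite gt0_ltr_powR ?nnegrE ?(ltW Np).
Qed.

(** The variational inequality with uniform weights [1/n]; the factor [n^((2-p)/p)] is the square of
    the constant. *)
Lemma lpnorm_le_lpnorm2 x :
  lpnorm p n x <= n%:R `^ (1 / p - 1 / 2) * lpnorm 2 n x.
Proof.
have /andP[p1 p2] := hp.
have nR : 0 < n%:R :> R by rewrite ltr0n.
have w1 : \sum_(i < n) (n%:R^-1 : R) = 1.
  by rewrite sumr_const card_ord -[LHS]mulr_natr mulVf// gt_eqF.
have w0 (i : 'I_n) : 0 < n%:R^-1 :> R by rewrite invr_gt0.
have := lpnorm_sqr_le_weighted p hp n x (fun=> n%:R^-1) w0 w1.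
rewrite -mulr_suml => H.
rewrite -(@ler_pXn2r _ 2) ?nnegrE ?lpnorm_ge0 ?mulr_ge0 ?powR_ge0//.
apply: le_trans H _; rewrite exprMn lpnorm_sqr.
rewrite divff ?pnatr_eq0// powRr1; last first.
  by apply: sumr_ge0 => i _; exact: powR_ge0.
rewrite mulrC -(powR_inv1 (ltW nR)) -powRrM mulN1r opprK.
rewrite -powR_mulrn ?powR_ge0// -powRrM.
rewrite (_ : (1 / p - 1 / 2) * 2 = (2 - p) / p); last by field; rewrite gt_eqF.
rewrite ler_wpM2l ?powR_ge0//; apply: ler_sum => i _.
by rewrite powR_mulrn// real_normK ?num_real.
Qed.

End lpnorm_norm.

Theorem corollary1 (R : realType) (p r : R) (n : nat)
    (hp : 1 < p <= 2) (hr : 0 < r) (hn : (0 < n)%N) :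
  strongly_convex (lpnorm p n) ((p - 1) / r) (lpball p n r) /\
  strongly_convex (lpnorm 2 n)
    ((p - 1) * n%:R `^ (1 / 2 - 1 / p) / r) (lpball p n r).
Proof.
have /andP[p1 _] := hp.
(* The exponent 2 lies in the admissible range, so the Euclidean norm is covered by the same
   lemmas. *)
have h2 : 1 < (2 : R) <= 2 by rewrite ltr1n lexx.
have nR : 0 < n%:R :> R by rewrite ltr0n.
have N1 := lpnorm_is_norm p hp n hn; have N2 := lpnorm_is_norm 2 h2 n hn.
have K1 := lpball_convex p hp n hn r hr.
split; split; [exact: N1 | exact: K1 | | exact: N2 | exact: K1 | ]
  => x y t z xr yr t01 z1; have /andP[t0 t1] := t01.
  apply: lpball_strongly_convex => //; rewrite lpnormZ// z1 mulr1 ger0_norm//.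
  by rewrite !mulr_ge0 ?lpnorm_ge0 ?subr_ge0 ?invr_ge0// ltW.
apply: lpball_strongly_convex => //; rewrite lpnormZ//.
rewrite ger0_norm; last first.
  by rewrite !mulr_ge0 ?powR_ge0 ?lpnorm_ge0 ?subr_ge0 ?invr_ge0// ltW.
have := lpnorm_le_lpnorm2 p hp n hn z; rewrite z1 mulr1 => zn.
apply: le_trans (ler_wpM2l _ zn) _.
  by rewrite !mulr_ge0 ?powR_ge0 ?lpnorm_ge0 ?subr_ge0 ?invr_ge0// ltW.
(* The factor [c] in the modulus cancels the bound on the p-norm of a Euclidean unit vector; what
   remains is the Euclidean norm of [x - y] against its p-norm. *)
set c := n%:R `^ (1 / 2 - 1 / p).
have cc : c * n%:R `^ (1 / p - 1 / 2) = 1.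
  rewrite -powRD; last by rewrite (gt_eqF nR) implybT.
  have -> : 1 / 2 - 1 / p + (1 / p - 1 / 2) = 0 by ring.
  exact: powRr0.
rewrite [leLHS](_ : _ = t * (1 - t) * ((p - 1) / r / 2)
  * lpnorm 2 n (x - y) ^+ 2 * (c * n%:R `^ (1 / p - 1 / 2))); last by ring.
rewrite cc mulr1; apply: ler_wpM2l.
  by rewrite !mulr_ge0 ?subr_ge0 ?invr_ge0// ltW.
by apply: lerXn2r; rewrite ?nnegrE ?lpnorm_ge0 ?lpnorm2_le.
Qed.
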